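(* For $k\ge1$ let $L_k=\frac12(3^k-1)=(1^k)_3$. (1) The path set presentation $(\mathcal{G}(L_k),v_0)$ for the path set $X(1,L_k)$ underlying $\mathcal{C}(1,L_k)$ has exactly $k$ vertices and is strongly connected. (2) For every $k\ge1$, $$\dim_H(\mathcal{C}(1,L_k))=\log_3\beta_k,$$ where $\beta_k$ is the unique real root greater than $1$ of $\lambda^k-\lambda^{k-1}-1=0$. (3) For all $k\ge3$, $$\dim_H(\mathcal{C}(1,L_k))=\frac{\log_3 k}{k}+O\!\left(\frac{\log\log k}{k}\right).$$
   Context: $\mathbb{Z}_3$ denotes the $3$-adic integers with the $3$-adic metric ($|3|_3=1/3$), and $\dim_H$ is Hausdorff dimension with respect to it. $\Sigma_3\subset\mathbb{Z}_3$ is the set of all $\sum_{j\ge0}a_j3^j$ with every $a_j\in\{0,1\}$. For an integer $M\ge1$, $\mathcal{C}(1,M)=\{\lambda\in\Sigma_3:M\lambda\in\Sigma_3\}$. The notation $(b_m\cdots b_1b_0)_3$ means $\sum_j b_j3^j$, and $(1^k)_3$ has $k$ digits equal to $1$. For $M\equiv1\pmod 3$, $X(1,M)\subset\{0,1\}^{\mathbb{N}}$ is the set of digit sequences $(a_0,a_1,\ldots)$ of elements $\sum a_j3^j$ of $\mathcal{C}(1,M)$, and its presentation $(\mathcal{G}(M),v_0)$ is the following labeled directed graph. From a vertex $v_N$ ($N$ a nonnegative integer) there is an outgoing edge labeled $a\in\{0,1\}$ exactly when $a+N\equiv0$ or $1\pmod3$, and this edge goes to $v_{N'}$ with $N'=\lfloor\frac{N+Ma}{3}\rfloor$.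 The vertices of $\mathcal{G}(M)$ are exactly those reachable from the marked vertex $v_0$ by such edges (a finite set). A directed graph is strongly connected if for any two vertices $i,j$ there is a directed path from $i$ to $j$. *)

(* Defs.v *)
From HB Require Import structures.
From mathcomp Require Import all_boot all_order all_algebra.
From mathcomp Require Import all_classical all_reals all_analysis.

Set Implicit Arguments.
Unset Strict Implicit.
Unset Printing Implicit Defensive.

Import Order.TTheory GRing.Theory Num.Theory.
Import numFieldNormedType.Exports.

Local Open Scope classical_set_scope.
Local Open Scope ring_scope.

(* Inverse limit of the rings Z/3^n: [res x n] is the representative in
   {0, ..., 3^n - 1} of x modulo 3^n.  The compatibility condition already
   forces [res x n < 3^n]. *)
Record Z3 := MkZ3 {
  res : nat -> nat;
  res_coherent : `[< forall n, (res n.+1 %% 3 ^ n)%N = res n >] }.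

HB.instance Definition _ := [isSub for res].
HB.instance Definition _ := [Choice of Z3 by <:].

Section Z3_ring.
Implicit Types x y z : Z3.

Lemma res_modS x n : (res x n.+1 %% 3 ^ n)%N = res x n.
Proof. by move/asboolP: (res_coherent x). Qed.

Lemma res_mod x n : (res x n %% 3 ^ n)%N = res x n.
Proof. by rewrite -res_modS modn_mod. Qed.

Lemma res_modD x m n : (res x (m + n) %% 3 ^ n)%N = res x n.
Proof.
elim: m => [|m IHm]; first exact: res_mod.
by rewrite -IHm addSn -(res_modS x (m + n)) expnD mulnC modn_dvdm ?dvdn_mulr.
Qed.

Lemma Z3P x y : (forall n, res x n = res y n) -> x = y.
Proof. by move=> e; apply/val_inj/funext. Qed.

Fact modn_coherent (f : nat -> nat) :
  (forall n, f n.+1 = f n %[mod 3 ^ n])%N ->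
  `[< forall n, ((f n.+1 %% 3 ^ n.+1) %% 3 ^ n)%N = (f n %% 3 ^ n)%N >].
Proof.
by move=> fP; apply/asboolP => n; rewrite modn_dvdm ?fP// expnS dvdn_mull.
Qed.

Definition Z3_of_seq f (fP : (forall n, f n.+1 = f n %[mod 3 ^ n])%N) : Z3 :=
  MkZ3 (modn_coherent fP).

Definition Z3_nat (m : nat) : Z3 := @Z3_of_seq (fun=> m) (fun=> erefl).

Fact Z3_add_subproof x y n :
  (res x n.+1 + res y n.+1 = res x n + res y n %[mod 3 ^ n])%N.
Proof. by rewrite -modnDm !res_modS. Qed.

Definition Z3_add x y : Z3 := Z3_of_seq (Z3_add_subproof x y).

Fact Z3_mul_subproof x y n :
  (res x n.+1 * res y n.+1 = res x n * res y n %[mod 3 ^ n])%N.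
Proof. by rewrite -modnMm !res_modS. Qed.

Definition Z3_mul x y : Z3 := Z3_of_seq (Z3_mul_subproof x y).

Lemma res_lt x n : (res x n < 3 ^ n)%N.
Proof. by rewrite -res_mod ltn_pmod// expn_gt0. Qed.

Fact Z3_opp_subproof x n :
  (3 ^ n.+1 - res x n.+1 = 3 ^ n - res x n %[mod 3 ^ n])%N.
Proof.
apply/eqP; rewrite -(eqn_modDr (res x n.+1)) subnK; last exact/ltnW/res_lt.
rewrite expnS modnMl -modnDmr res_modS subnK ?modnn//; exact/ltnW/res_lt.
Qed.

Definition Z3_opp x : Z3 := Z3_of_seq (Z3_opp_subproof x).

Fact Z3_addA : associative Z3_add.
Proof. by move=> x y z; apply: Z3P => n /=; rewrite modnDmr modnDml addnA. Qed.

Fact Z3_addC : commutative Z3_add.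
Proof. by move=> x y; apply: Z3P => n /=; rewrite addnC. Qed.

Fact Z3_add0 : left_id (Z3_nat 0) Z3_add.
Proof. by move=> x; apply: Z3P => n /=; rewrite mod0n add0n res_mod. Qed.

Fact Z3_addN : left_inverse (Z3_nat 0) Z3_opp Z3_add.
Proof.
move=> x; apply: Z3P => n /=.
by rewrite modnDml subnK ?modnn ?mod0n//; exact/ltnW/res_lt.
Qed.

HB.instance Definition _ :=
  GRing.isZmodule.Build Z3 Z3_addA Z3_addC Z3_add0 Z3_addN.

Fact Z3_mulA : associative Z3_mul.
Proof. by move=> x y z; apply: Z3P => n /=; rewrite modnMmr modnMml mulnA. Qed.

Fact Z3_mulC : commutative Z3_mul.
Proof. by move=> x y; apply: Z3P => n /=; rewrite mulnC. Qed.

Fact Z3_mul1 : left_id (Z3_nat 1) Z3_mul.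
Proof. by move=> x; apply: Z3P => n /=; rewrite modnMml mul1n res_mod. Qed.

Fact Z3_mulDl : left_distributive Z3_mul Z3_add.
Proof.
by move=> x y z; apply: Z3P => n /=; rewrite modnMml mulnDl modnDm.
Qed.

Fact Z3_one_neq0 : Z3_nat 1 != Z3_nat 0.
Proof. by apply/eqP => /(congr1 (res^~ 1%N)). Qed.

HB.instance Definition _ := GRing.Zmodule_isComNzRing.Build Z3
  Z3_mulA Z3_mulC Z3_mul1 Z3_mulDl Z3_one_neq0.

Lemma res0 n : res 0 n = 0%N. Proof. exact: mod0n. Qed.

Lemma resD x y n : res (x + y) n = ((res x n + res y n) %% 3 ^ n)%N.
Proof. by []. Qed.

Lemma resM x y n : res (x * y) n = ((res x n * res y n) %% 3 ^ n)%N.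
Proof. by []. Qed.

Lemma res_nat m n : res m%:R n = (m %% 3 ^ n)%N.
Proof.
elim: m => [|m IHm]; first by rewrite res0 mod0n.
by rewrite -natr1 resD IHm [res 1 n]/= modnDm addn1.
Qed.

Lemma res_eq x y n : res (x - y) n = 0%N <-> res x n = res y n.
Proof.
have -> : res x n = ((res (x - y)%R n + res y n) %% 3 ^ n)%N.
  by rewrite -resD subrK.
split=> [->|/eqP]; first by rewrite add0n res_mod.
rewrite -[X in _ == X](res_mod y) -[X in _ == (X %% _)%N]add0n.
by rewrite eqn_modDr res_mod mod0n => /eqP.
Qed.

End Z3_ring.

Section Z3_uniform.

Definition Z3_ent : set_system (Z3 * Z3) :=
  [set E | exists n, forall x y, res x n = res y n -> E (x, y)].

Local Open Scope relation_scope.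

Fact Z3_ent_filter : Filter Z3_ent.
Proof.
split; first by exists 0%N.
  move=> A B [m Am] [n Bn]; exists (m + n)%N => x y e; split.
    by apply: Am; rewrite -(res_modD x n) -(res_modD y n) addnC e.
  by apply: Bn; rewrite -(res_modD x m) -(res_modD y m) e.
by move=> A B AB [n An]; exists n => x y e; exact/AB/An.
Qed.

Fact Z3_ent_diag A : Z3_ent A -> diagonal `<=` A.
Proof. by move=> [n An] [x y] xy; apply: An; exact: (congr1 (res^~ n) xy). Qed.

Fact Z3_ent_inv A : Z3_ent A -> Z3_ent A^-1.
Proof. by move=> [n An]; exists n => x y e; exact: An. Qed.

Fact Z3_ent_split A : Z3_ent A -> exists2 B, Z3_ent B & B \; B `<=` A.
Proof.
move=> [n An]; exists [set p | res p.1 n = res p.2 n]; first by exists n.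
by move=> [x y] [z /= xz zy]; apply: An; rewrite xz.
Qed.

HB.instance Definition _ :=
  isUniform.Build Z3 Z3_ent_filter Z3_ent_diag Z3_ent_inv Z3_ent_split.

End Z3_uniform.

Section Z3_metric.
Variable R : realType.
Implicit Types x y z : Z3.

(* |x|_3 is the infimum of the 3^-n over the n such that 3^n divides x. *)
Definition abs3 x : R := inf [set 3 ^- n | n in [set n | res x n = 0%N]].

Definition dist3 x y : R := abs3 (x - y).

Lemma abs3_le x n : abs3 x <= 3 ^- n <-> res x n = 0%N.
Proof.
have lb : has_lbound [set (3 ^- n : R) | n in [set n | res x n = 0%N]].
  by exists 0 => _ [m _ <-]; rewrite invr_ge0 exprn_ge0.
split=> [le|xn]; last by apply: ge_inf => //; exists n.
apply: contrapT => xn.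
case: n => [|n] in le xn; first by case: xn; rewrite -res_mod modn1.
suff : 3 ^- n <= abs3 x.
  move=> /le_trans /(_ le); rewrite lef_pV2 ?posrE ?exprn_gt0//.
  by rewrite ler_eXn2l ?ltr1n// ltnn.
apply: lb_le_inf.
  by exists (3 ^- 0), 0%N => //=; rewrite -res_mod modn1.
move=> _ [m /= xm <-]; rewrite lef_pV2 ?posrE ?exprn_gt0//.
rewrite ler_eXn2l ?ltr1n// leqNgt; apply/negP => nm; apply: xn.
by rewrite -(res_modD x (m - n.+1)) subnK// xm mod0n.
Qed.

Lemma abs3_ge0 x : 0 <= abs3 x.
Proof.
apply: lb_le_inf; first by exists (3 ^- 0), 0%N => //=; rewrite -res_mod modn1.
by move=> _ [m _ <-]; rewrite invr_ge0 exprn_ge0.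
Qed.

Lemma dist3_le x y n : dist3 x y <= 3 ^- n <-> res x n = res y n.
Proof. by rewrite abs3_le res_eq. Qed.

Lemma exp3_small (e : R) : 0 < e -> exists n, 3 ^- n < e.
Proof.
move=> e0; exists (Num.truncn e^-1).+1.
rewrite invf_plt ?posrE ?exprn_gt0//.
apply: (lt_le_trans (truncnS_gt _)).
by rewrite -natrX ler_nat ltnW// ltn_expl.
Qed.

Lemma dist3_ltP x y (e : R) : 0 < e ->
  dist3 x y < e <-> exists2 n, 3 ^- n < e & res x n = res y n.
Proof.
move=> e0; split=> [|[n ne /dist3_le xy]]; last exact: le_lt_trans ne.
case: (pselect (exists n, res x n <> res y n)) => [xy|]; last first.
  move=> /forallNP xy _; have [n ne] := exp3_small e0.
  by exists n => //; apply: contrapT; exact: xy.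
move=> xye; have [_ [n nxy <-] ne] : exists2 r,
    [set (3 ^- n : R) | n in [set n | res (x - y) n = 0%N]] r & r < e.
  apply: inf_lt xye.
  by exists (3 ^- 0), 0%N => //=; rewrite -res_mod modn1.
by exists n => //; apply/res_eq.
Qed.

Definition ball3 x (e : R) : set Z3 := [set y | dist3 x y < e].

Fact dist3_ge0 x y : 0 <= dist3 x y. Proof. exact: abs3_ge0. Qed.

Fact dist3_eq0 x y : dist3 x y = 0 -> x = y.
Proof.
by move=> xy; apply: Z3P => n; apply/dist3_le; rewrite xy invr_ge0 exprn_ge0.
Qed.

Lemma dist3_gt0 x y (e : R) : dist3 x y < e -> 0 < e.
Proof. exact/le_lt_trans/dist3_ge0. Qed.

Fact ball3_center x (e : R) : 0 < e -> ball3 x e x.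
Proof. by move=> e0; apply/dist3_ltP => //; have [n] := exp3_small e0; exists n. Qed.

Fact ball3_sym x y (e : R) : ball3 x e y -> ball3 y e x.
Proof.
move=> xy; have e0 := dist3_gt0 xy.
by move/(dist3_ltP _ _ e0): xy => [n ne xy]; apply/(dist3_ltP _ _ e0); exists n.
Qed.

Fact ball3_triangle x y z (d e : R) :
  ball3 x d y -> ball3 y e z -> ball3 x (d + e) z.
Proof.
move=> xy yz; have d0 := dist3_gt0 xy; have e0 := dist3_gt0 yz.
move/(dist3_ltP _ _ d0): xy => [m md xy].
move/(dist3_ltP _ _ e0): yz => [n ne yz].
apply/dist3_ltP; first exact: addr_gt0.
have [mn|/ltnW nm] := leqP m n.
  exists m; first by rewrite (lt_trans md)// ltrDl.
  by rewrite xy -(res_modD y (n - m)) -(res_modD z (n - m)) subnK// yz.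
exists n; first by rewrite (lt_trans ne)// ltrDr.
by rewrite -yz -(res_modD y (m - n)) -(res_modD x (m - n)) subnK// xy.
Qed.

Fact Z3_entE : @entourage Z3 = entourage_ ball3.
Proof.
apply/seteqP; split=> E.
  move=> [n En]; exists (3 ^- n); first by rewrite /= invr_gt0 exprn_gt0.
  by move=> [x y] /= xy; apply/En/dist3_le/ltW.
move=> [e /= e0 eE]; have [n ne] := exp3_small e0.
by exists n => x y xy; apply: eE => /=; apply/dist3_ltP => //; exists n.
Qed.

HB.instance Definition _ := Uniform_isPseudoMetric.Build R Z3
  ball3_center ball3_sym ball3_triangle Z3_entE.

HB.instance Definition _ := @PseudoMetric_isMetric.Build R Z3
  dist3 dist3_ge0 dist3_eq0 (fun _ _ => erefl).

Lemma abs3_3 : abs3 3 = 3^-1.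
Proof.
apply/eqP; rewrite eq_le; apply/andP; split.
  by apply/(abs3_le 3 1); rewrite res_nat modnn.
apply: lb_le_inf; first by exists (3 ^- 0), 0%N => //=; rewrite -res_mod modn1.
move=> _ [[|[|n]] xn <-].
- by rewrite expr0 invr1 invf_le1// ler1n.
- by rewrite expr1.
have : res 3 n.+2 = 0%N by [].
by rewrite res_nat modn_small// -[ltnLHS](expn1 3) ltn_exp2l.
Qed.

End Z3_metric.

Section hausdorff_dimension.
Context {R : realType} {T : metricType R}.
Implicit Types (A U : set T) (s : R).
Local Open Scope ereal_scope.

Definition diam U : \bar R :=
  if U == set0 then 0
  else ereal_sup [set (mdist p.1 p.2)%:E | p in U `*` U].

(* The empty set has weight 0 for every exponent, including s = 0, for which
   a nonempty set has weight 1 (x `^ 0 = 1 for every x). *)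
Definition diam_pow s U : \bar R :=
  if U == set0 then 0 else (diam U `^ s)%E.

Definition hausdorff_premeasure s (delta : R) A : \bar R :=
  ereal_inf [set \sum_(0 <= i <oo) diam_pow s (U i) | U in
    [set U : (set T)^nat | A `<=` \bigcup_i U i /\
                           forall i, diam (U i) <= delta%:E]].

Definition hausdorff_measure s A : \bar R :=
  ereal_sup [set hausdorff_premeasure s delta A | delta in [set delta | 0 < delta]%R].

Definition dimH A : \bar R :=
  ereal_inf [set s%:E | s in [set s | (0 <= s)%R /\ hausdorff_measure s A = 0]].

End hausdorff_dimension.

Definition ternary_expansion (a : nat -> bool) (x : Z3) : Prop :=
  series (fun j => (a j)%:R * 3 ^+ j : Z3) @ \oo --> x.

Definition Sigma3 : set Z3 :=
  [set x | exists a : nat -> bool, ternary_expansion a x].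

Definition C1 (M : nat) : set Z3 := [set x | Sigma3 x /\ Sigma3 (M%:R * x)].

Definition X1 (M : nat) : set (nat -> bool) :=
  [set a | exists2 x, C1 M x & ternary_expansion a x].

(* The vertex v_N is represented by N. *)
Definition edge (M : nat) (a : bool) : rel nat := fun N N' =>
  (((a + N == 0 %[mod 3]) || (a + N == 1 %[mod 3])) &&
   (N' == (N + M * a) %/ 3))%N.

Definition graph_rel (M : nat) : rel nat := fun N N' => [exists a, edge M a N N'].

Definition vertices (M : nat) : set nat :=
  [set N | exists2 p, path (graph_rel M) 0%N p & last 0%N p = N].

Definition strongly_connected (V : set nat) (e : rel nat) : Prop :=
  forall i j, V i -> V j ->
    exists p, [/\ path e i p, last i p = j & forall v, v \in p -> V v].

(* Label sequences of the infinite walks starting at the marked vertex. *)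
Definition path_set (M : nat) : set (nat -> bool) :=
  [set a | exists v : nat -> nat,
     v 0%N = 0%N /\ forall j, edge M (a j) (v j) (v j.+1)].

Definition repunit3 (k : nat) : nat := (3 ^ k - 1)./2.

Lemma repunit3E k : repunit3 k = (\sum_(j < k) 3 ^ j)%N.
Proof. by rewrite /repunit3 subn1 predn_exp mul2n doubleK. Qed.

Definition log3 {R : realType} (x : R) : R := ln x / ln 3.

(* Main.v *)
(* The carry in the multiplication of [sum a_j 3^j] by [L_k] is always some [L_j] with [j < k]: a
   digit 1 is allowed only at carry [L_0 = 0] and moves it to [L_(k-1)], a digit 0 moves [L_j] to
   [L_(j-1)].  So consecutive 1s of [a] are at least [k] places apart.  The weights [beta^-(n+j)] of
   the admissible prefixes of length [n] with carry [L_j] are additive under extension.  Hence there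
   are at most [beta^(n+k-1)] prefixes of length [n], which bounds the dimension above by
   [log_3 beta]; and if cylinders of levels [l_i] have [sum beta^-l_i < 1], one can descend the tree
   of prefixes keeping the weight of the cylinders below a prefix smaller than the weight of that
   prefix, and reach a point of [C(1, L_k)] that none of the cylinders contains, which bounds the
   dimension below. *)
Require Import Defs.
From mathcomp Require Import all_boot all_order all_algebra.
From mathcomp Require Import all_classical all_reals all_analysis.
From mathcomp Require Import zify ring lra.

Import Order.TTheory GRing.Theory Num.Theory.
Import numFieldNormedType.Exports.

Local Open Scope classical_set_scope.
Local Open Scope ring_scope.

(** * Digit sums and ternary expansions in the 3-adic integers *)

Definition digit_sum (b : nat -> nat) (n : nat) : nat := \sum_(j < n) b j * 3 ^ j.

Lemma digit_sumS b n : digit_sum b n.+1 = (digit_sum b n + b n * 3 ^ n)%N.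
Proof. by rewrite /digit_sum big_ord_recr. Qed.

Lemma digit_sum_lt b n : (forall j, b j < 3)%N -> (digit_sum b n < 3 ^ n)%N.
Proof.
move=> b3; elim: n => [|n IHn]; first by rewrite /digit_sum big_ord0.
rewrite digit_sumS expnS (leq_trans (n := 3 ^ n + 2 * 3 ^ n)%N)//.
by rewrite -addSn leq_add// leq_mul2r -ltnS b3 orbT.
Qed.

Lemma digit_sum_inj b c n : (forall j, b j < 3)%N -> (forall j, c j < 3)%N ->
  digit_sum b n.+1 = digit_sum c n.+1 -> b n = c n.
Proof.
move=> b3 c3; rewrite !digit_sumS => /(congr1 (divn^~ (3 ^ n)%N)).
rewrite ![(digit_sum _ n + _)%N]addnC !divnMDl ?expn_gt0//.
by rewrite !divn_small ?digit_sum_lt// !addn0.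
Qed.

Lemma digit_sum_coherent b n : digit_sum b n.+1 = digit_sum b n %[mod 3 ^ n].
Proof. by rewrite digit_sumS addnC modnMDl. Qed.

Lemma res_series (a : nat -> bool) n :
  forall m, res (series (fun j => (a j)%:R * 3 ^+ j : Z3) m) n
  = (digit_sum a m %% 3 ^ n)%N.
Proof.
elim=> [|m IHm].
  by rewrite /series/= big_geq// res0 /digit_sum big_ord0 mod0n.
rewrite seriesSr resD IHm digit_sumS.
by rewrite -natrX -natrM res_nat modnDm.
Qed.

(** Convergence in [Z3] means that every residue is eventually constant, and from stage [n] on the
    partial sums no longer change modulo [3 ^ n]. *)
Lemma ternary_expansionP (a : nat -> bool) (x : Z3) :
  ternary_expansion a x <-> forall n, res x n = digit_sum a n.
Proof.
have a3 j : (a j < 3)%N by case: (a j).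
have mod_le n d : (digit_sum a (d + n) %% 3 ^ n)%N = digit_sum a n.
  elim: d => [|d IHd]; first by rewrite modn_small// digit_sum_lt.
  rewrite addSn -[RHS]IHd digit_sumS expnD mulnA addnC modnMDl.
  by [].
rewrite /ternary_expansion; split=> [/cvg_entourageP ax n|ax].
  have : entourage [set p : Z3 * Z3 | res p.1 n = res p.2 n] by exists n.
  move=> /ax [N _ /(_ (N + n)%N)]/= => ->; last by rewrite /= leq_addr.
  by rewrite res_series mod_le.
apply/cvg_entourageP => E [n En].
exists n => // m /= nm; apply: En.
by rewrite res_series ax -(subnK nm) mod_le.
Qed.

Definition Z3_digits (a : nat -> bool) : Z3 := Z3_of_seq (digit_sum_coherent a).

Lemma Z3_digitsP a : ternary_expansion a (Z3_digits a).
Proof.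
apply/ternary_expansionP => n /=.
by rewrite modn_small// digit_sum_lt// => j; case: (a j).
Qed.

(** * Multiplication by M as long multiplication with carries *)

Fixpoint carry (M : nat) (a : nat -> bool) (n : nat) : nat :=
  if n is m.+1 then ((carry M a m + M * a m) %/ 3)%N else 0%N.

Definition carry_digit M a n := ((carry M a n + M * a n) %% 3)%N.

Lemma carry_digit_lt M a n : (carry_digit M a n < 3)%N.
Proof. exact: ltn_pmod. Qed.

Lemma mul_digit_sum M (a : nat -> bool) n :
  (M * digit_sum a n)%N = (digit_sum (carry_digit M a) n + carry M a n * 3 ^ n)%N.
Proof.
elim: n => [|n IHn]; first by rewrite /digit_sum !big_ord0 muln0.
rewrite !digit_sumS /= mulnDr IHn -addnA -[RHS]addnA; congr (_ + _)%N.
rewrite mulnA expnS mulnA -!mulnDl; congr (_ * _)%N.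
by rewrite [RHS]addnC -divn_eq addnC.
Qed.

(** As M is 1 modulo 3, the digit of the product at place [n] is [a n] plus the carry, modulo 3. The
    edge condition thus says that this digit is 0 or 1, and the vertices along a walk are the
    carries. *)
Lemma X1_path_set M : (M = 1 %[mod 3])%N -> X1 M = path_set M.
Proof.
move=> M1; have digE a n : carry_digit M a n = ((a n + carry M a n) %% 3)%N.
  by rewrite /carry_digit -modnDmr -modnMml M1 modnMml mul1n modnDmr addnC.
have carryP a : path_set M a <-> forall n, (carry_digit M a n < 2)%N.
  have d2 n : (carry_digit M a n < 2)%N =
      (((a n + carry M a n)%N == 0 %[mod 3]) || ((a n + carry M a n)%N == 1 %[mod 3])).
    by rewrite digE; case: (_ %% 3)%N (ltn_pmod (a n + carry M a n) (isT : 0 < 3)%N) => [|[|[|]]].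
  split=> [[v [v0 vP]] n|aP]; last first.
    by exists (carry M a); split=> // j; rewrite /edge -d2 aP /=.
  have vE m : v m = carry M a m.
    by elim: m => [|m IHm]//=; move/andP: (vP m) => [_ /eqP ->]; rewrite IHm.
  by rewrite d2 -vE; move/andP: (vP n) => [].
have resE a x n : ternary_expansion a x ->
    res (M%:R * x) n = digit_sum (carry_digit M a) n.
  move=> /ternary_expansionP ax; rewrite resM res_nat modnMml ax mul_digit_sum.
  rewrite addnC modnMDl modn_small// digit_sum_lt// => j; exact: carry_digit_lt.
apply/seteqP; split=> a.
  (* Base-3 digits are unique, so a 0/1 expansion of [M%:R * x] must be the one computed with
     carries. *)
  move=> [x [_ [b /ternary_expansionP bx]] ax]; apply/carryP => n.
  have b3 j : (b j < 3)%N by case: (b j).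
  have <- : b n = carry_digit M a n :> nat.
    apply: (digit_sum_inj b _ n b3 (carry_digit_lt M a)).
    by rewrite -bx (resE _ _ _ ax).
  by case: (b n).
move=> /carryP aP; exists (Z3_digits a); last exact: Z3_digitsP.
split; first by exists a; exact: Z3_digitsP.
exists (fun n => carry_digit M a n == 1%N); apply/ternary_expansionP => n.
rewrite (resE a)//; last exact: Z3_digitsP.
apply: eq_bigr => j _; congr (_ * _)%N.
by move: (aP j); case: (carry_digit _ _ _) => [|[|]].
Qed.

(** * The graph of a repunit *)

Lemma repunit3S k : repunit3 k.+1 = (3 * repunit3 k + 1)%N.
Proof.
rewrite !repunit3E big_ord_recl addnC big_distrr/=; congr (_ + _)%N.
by apply: eq_bigr => i _; rewrite -expnS.
Qed.

Lemma repunit30 : repunit3 0 = 0%N. Proof. by []. Qed.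

Lemma repunit3_mod k : (1 <= k)%N -> (repunit3 k = 1 %[mod 3])%N.
Proof. by case: k => // k _; rewrite repunit3S mulnC modnMDl. Qed.

Lemma repunit3_div k : (repunit3 k %/ 3)%N = repunit3 k.-1.
Proof. by case: k => // k; rewrite repunit3S mulnC divnMDl// addn0. Qed.

Lemma repunit3_inj : injective repunit3.
Proof.
move=> m n mn; have pow k : (3 ^ k = (repunit3 k).*2.+1)%N.
  by elim: k => // k IHk; rewrite expnS IHk repunit3S; lia.
by apply: (@expnI 3) => //; rewrite !pow mn.
Qed.

(** States index the carries [repunit3 j]. For digit 1 the state is not consulted, since that digit
    is allowed only at [j = 0]; for digit 0, [0.-1 = 0] gives the loop at the marked vertex. *)
Definition next_state (k : nat) (a : bool) (j : nat) : nat := if a then k.-1 else j.-1.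

(** For [j > 0] the carry is 1 modulo 3, so digit 1 would produce the forbidden residue 2. Division
    by 3 removes the last digit of a repunit. *)
Lemma edge_repunit3 k a j N : (1 <= k)%N ->
  edge (repunit3 k) a (repunit3 j) N =
  (a ==> (j == 0%N)) && (N == repunit3 (next_state k a j)).
Proof.
move=> k1; rewrite /edge.
have j1 : j != 0%N -> ((a + repunit3 j) %% 3)%N = a.+1.
  case: j => // j _; rewrite repunit3S addnCA mulnC modnMDl addn1 modn_small//.
  by case: a.
case: (eqVneq j 0%N) => [->|j0]; last first.
  rewrite j1//; case: a {j1} => //=.
  by rewrite muln0 addn0 repunit3_div.
rewrite repunit30 addn0 add0n; case: a {j1} => //=.
  by rewrite muln1 repunit3_div.
by rewrite muln0 div0n.
Qed.

Lemma next_state_lt k a j : (1 <= k)%N -> (j < k)%N -> (next_state k a j < k)%N.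
Proof.
move=> k1 jk; rewrite /next_state; case: a; first by rewrite prednK.
exact: leq_ltn_trans (leq_pred j) jk.
Qed.

Lemma path_setP k (a : nat -> bool) : (1 <= k)%N ->
  path_set (repunit3 k) a <->
  exists s : nat -> nat, s 0%N = 0%N /\
    forall n, (a n -> s n = 0%N) /\ s n.+1 = next_state k (a n) (s n).
Proof.
move=> k1; split=> [[v [v0 vP]]|[s [s0 sP]]]; last first.
  exists (repunit3 \o s); split=> [|n /=]; first by rewrite /= s0.
  have [as0 ->] := sP n; rewrite edge_repunit3// eqxx andbT.
  by apply/implyP => /as0 ->.
pose s := fix s n := if n is m.+1 then next_state k (a m) (s m) else 0%N.
have vE n : v n = repunit3 (s n).
  elim: n => [|n IHn]//; have := vP n.
  by rewrite IHn edge_repunit3// => /andP[_ /eqP].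
exists s; split=> // n; split=> // an; apply/eqP.
by have := vP n; rewrite vE edge_repunit3// an => /andP[].
Qed.

Lemma vertices_path M i p : vertices M i -> path (graph_rel M) i p ->
  forall v, v \in p -> vertices M v.
Proof.
move=> [q q0 <-] ip v vp; case/splitPr: vp ip => p1 p2.
rewrite cat_path/= => /and3P[p1P p1v _]; exists (q ++ rcons p1 v).
  by rewrite cat_path q0 rcons_path p1P.
by rewrite last_cat last_rcons.
Qed.

Lemma graph_rel_repunit3 k j N : (1 <= k)%N ->
  graph_rel (repunit3 k) (repunit3 j) N =
  (N == repunit3 j.-1) || (j == 0%N) && (N == repunit3 k.-1).
Proof.
move=> k1; apply/existsP/idP => [[a]|/orP[Nj|/andP[j0 Nk]]].
- by rewrite edge_repunit3//; case: a => /= [/andP[-> ->]|->]//; rewrite orbT.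
- by exists false; rewrite edge_repunit3.
- by exists true; rewrite edge_repunit3// j0.
Qed.

Lemma path_down k d j : (1 <= k)%N -> exists2 p,
  path (graph_rel (repunit3 k)) (repunit3 (d + j)) p &
  last (repunit3 (d + j)) p = repunit3 j.
Proof.
move=> k1; elim: d => [|d [p pP pl]]; first by exists [::].
exists (repunit3 (d + j) :: p) => //=.
by rewrite graph_rel_repunit3// addSn eqxx.
Qed.

(** Carries stay among these repunits by [edge_repunit3]; conversely digit 1 jumps from 0 to
    [repunit3 k.-1], and digits 0 then descend to each smaller one. *)
Lemma vertices_repunit3 k : (1 <= k)%N ->
  vertices (repunit3 k) = repunit3 @` `I_k.
Proof.
move=> k1; apply/seteqP; split=> [N [p pP <-]|_ [j jk <-]].
  have := pP; have : (repunit3 @` `I_k) 0%N by exists 0%N.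
  move: {pP} 0%N; elim: p => //= N' p IHp _ [j jk <-] /andP[+ pP].
  rewrite graph_rel_repunit3// => N'E; apply: IHp pP.
  case/orP: N'E => [/eqP ->|/andP[_ /eqP ->]].
    by exists j.-1 => //; exact: leq_ltn_trans (leq_pred j) jk.
  by exists k.-1 => //=; rewrite prednK.
have [p] := path_down k (k.-1 - j) j k1.
have jk' : (j <= k.-1)%N by rewrite -ltnS prednK.
rewrite subnK// => pP pl; exists (repunit3 k.-1 :: p) => //=.
by rewrite pP -[X in graph_rel _ X]repunit30 graph_rel_repunit3// !eqxx orbT.
Qed.

Lemma card_vertices k : (1 <= k)%N -> (vertices (repunit3 k) #= `I_k)%card.
Proof.
move=> k1; rewrite vertices_repunit3//.
by apply: inj_card_eq => ? ? _ _; exact: repunit3_inj.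
Qed.

(** Every vertex descends to 0 by digits 0, and 0 reaches every vertex by definition. *)
Lemma strongly_connected_repunit3 k : (1 <= k)%N ->
  strongly_connected (vertices (repunit3 k)) (graph_rel (repunit3 k)).
Proof.
move=> k1 i j iV [q qP qj].
have [l _ li] : (repunit3 @` `I_k) i by rewrite -vertices_repunit3.
have [p] := path_down k l 0 k1; rewrite addn0 li => pP p0.
have pq : path (graph_rel (repunit3 k)) i (p ++ q) by rewrite cat_path pP p0.
exists (p ++ q); split=> //; first by rewrite last_cat p0.
exact: vertices_path iV pq.
Qed.

(** * Admissible digit sequences and the tree of their prefixes *)

(* The state [j] stands for the carry [repunit3 j]. *)
Definition admissible (k : nat) (a : nat -> bool) : Prop :=
  exists s : nat -> nat, s 0%N = 0%N /\
    forall n, (a n -> s n = 0%N) /\ s n.+1 = next_state k (a n) (s n).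

Lemma C1_repunit3P k x : (1 <= k)%N ->
  C1 (repunit3 k) x <-> exists2 a, admissible k a & ternary_expansion a x.
Proof.
move=> k1; have XP a : X1 (repunit3 k) a <-> admissible k a.
  by rewrite X1_path_set ?repunit3_mod// path_setP.
split=> [Cx|[a /XP[y Cy ay] ax]].
  by have [[a ax] _] := Cx; exists a => //; apply/XP; exists x.
suff -> : x = y by [].
apply: Z3P => n; move/ternary_expansionP: ax => ->.
by move/ternary_expansionP: ay => ->.
Qed.

(* The residues mod [3 ^ n] reachable in [n] steps from the state [j]. *)
Fixpoint words (k n j : nat) : seq nat :=
  if n is m.+1 then
    if j is i.+1 then map (muln 3) (words k m i)
    else map (muln 3) (words k m 0) ++ map (fun w => 3 * w + 1)%N (words k m k.-1)
  else [:: 0%N].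

(** Induction on the first digit: the shifted sequence starts in the state [s 1], which is why the
    lemma allows any initial state. *)
Lemma digit_sum_words k (a : nat -> bool) (s : nat -> nat) n :
  (forall n, (a n -> s n = 0%N) /\ s n.+1 = next_state k (a n) (s n)) ->
  digit_sum a n \in words k n (s 0%N).
Proof.
elim: n a s => [|n IHn] a s sP; first by rewrite /digit_sum big_ord0.
have := IHn (a \o S) (s \o S) (fun n => sP n.+1); have [a0 /= ->] := sP 0%N.
have -> : digit_sum a n.+1 = (3 * digit_sum (a \o S) n + a 0%N)%N.
  rewrite /digit_sum big_ord_recl addnC muln1 big_distrr/=; congr (_ + _)%N.
  by apply: eq_bigr => i _; rewrite expnS mulnCA.
rewrite /next_state; case: (a 0%N) a0 => [->// wn|_ wn].
  by rewrite mem_cat orbC (map_f (fun w => 3 * w + 1)%N).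
rewrite addn0; case: (s 0%N) wn => [|i] wn; last exact: map_f.
by rewrite mem_cat (map_f (muln 3)).
Qed.

Section growth.
Context {R : realType}.
Variables (k : nat) (beta : R).
Hypotheses (k1 : (1 <= k)%N) (beta1 : 1 < beta).
Hypothesis betaE : beta ^+ k = beta ^+ k.-1 + 1.

Let beta_gt0 : 0 < beta. Proof. exact: lt_trans beta1. Qed.

(** At state 0 the two branches add up to [beta ^+ n * (beta ^+ k.-1 + 1)], which is
    [beta ^+ (n + k)]. At a positive state the only step keeps the exponent unchanged. *)
Lemma size_words n j : (j <= k.-1)%N ->
  (size (words k n j))%:R <= beta ^+ (n + (k.-1 - j)).
Proof.
elim: n j => [|n IHn] j jk; first by rewrite /= exprn_ege1// ltW.
case: j jk => [|j] jk /=.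
  rewrite size_cat !size_map natrD subn0.
  apply: (le_trans (lerD (IHn 0%N (leq0n _)) (IHn k.-1 (leqnn _)))).
  by rewrite subnn subn0 addn0 addSnnS prednK// !exprD betaE mulrDr mulr1.
rewrite size_map (le_trans (IHn _ (ltnW jk)))//.
by rewrite addSnnS -subSn// subSS.
Qed.

Section avoiding.
Variables l c : nat -> nat.

(** The pair [(l i, c i)] stands for the cylinder of all [x] with [res x (l i) = c i]. The sum runs
    over the cylinders that lie below the prefix [r] of length [n]. *)
Let weight (n r : nat) : \bar R := (\sum_(0 <= i <oo)
  (if (n <= l i)%N && (c i %% 3 ^ n == r)%N then beta ^- l i else 0)%:E)%E.

Let light (n r j : nat) := (weight n r < (beta ^- (n + j))%:E)%E.

Let term_ge0 (n r i : nat) :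
  (0 <= (if (n <= l i)%N && (c i %% 3 ^ n == r)%N then beta ^- l i else 0)%:E)%E.
Proof. by rewrite lee_fin; case: ifP => // _; rewrite invr_ge0 exprn_ge0// ltW. Qed.

Let weight_ge0 n r : (0 <= weight n r)%E.
Proof. by apply: nneseries_ge0 => i _ _; exact: term_ge0. Qed.

(** A cylinder below one of the two children lies below [r], and never below both. Equality may
    fail: cylinders of level exactly [n], or continuing with digit 2, are lost. *)
Let weight_split n r : (r < 3 ^ n)%N ->
  (weight n.+1 r + weight n.+1 (r + 3 ^ n)%N <= weight n r)%E.
Proof.
move=> rn; rewrite /weight -nneseriesD; [|by move=> i _ _; exact: term_ge0..].
apply: lee_nneseries => [i _ _|i _]; first by rewrite adde_ge0.
rewrite -EFinD lee_fin; have [nl|nl] := ltnP n (l i); last first.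
  by rewrite /= addr0 -lee_fin term_ge0.
rewrite (ltnW nl)/=; have cE : (c i %% 3 ^ n = c i %% 3 ^ n.+1 %% 3 ^ n)%N.
  by rewrite modn_dvdm// dvdn_exp2l.
have b0 : 0 <= beta ^- l i by rewrite invr_ge0 exprn_ge0// ltW.
have [c1|c1] := eqVneq (c i %% 3 ^ n.+1)%N r.
  rewrite cE c1 modn_small// eqxx ifF ?addr0//.
  by apply/negbTE; rewrite -[X in X != _]addn0 eqn_add2l neq_ltn expn_gt0.
rewrite add0r; case: eqP => [c2|_]; last by case: ifP.
by rewrite cE c2 modnDr modn_small// eqxx.
Qed.

(** At a positive state the forced digit 0 leaves [n + j] unchanged. At state 0, two heavy children
    would together weigh at least [beta ^- n.+1 + beta ^- (n + k) = beta ^- n], so one child is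
    light; digit 1 is taken whenever its child is. *)
Let light_step n r j : (r < 3 ^ n)%N -> light n r j ->
  let d := (j == 0%N) && `[< light n.+1 (r + 3 ^ n)%N k.-1 >] in
  light n.+1 (r + d * 3 ^ n)%N (next_state k d j).
Proof.
move=> rn nrj /=; have split := weight_split n r rn.
have wr : (weight n.+1 r <= weight n r)%E.
  by apply: le_trans split; rewrite leeDl.
have [j0|j0] := eqVneq j 0%N; last first.
  rewrite /= /light mul0n addn0 (le_lt_trans wr)// (lt_le_trans nrj)//.
  by rewrite addSnnS prednK// lt0n.
case: asboolP => [|/negP]; first by rewrite mul1n.
rewrite /light -leNgt /= mul0n !addn0 j0 addn0 => heavy.
rewrite ltNge; apply/negP => heavy'.
move: nrj; rewrite /light j0 addn0 ltNge => /negP; apply.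
apply: le_trans split; apply: le_trans (leeD heavy' heavy).
rewrite -EFinD lee_fin addSnnS prednK// -(ler_pM2r (exprn_gt0 (n + k) beta_gt0)).
rewrite mulrDl mulVf ?expf_neq0 ?gt_eqF//.
rewrite exprD mulKf ?expf_neq0 ?gt_eqF//.
rewrite exprSr invfM mulrACA mulVf ?expf_neq0 ?gt_eqF// mul1r.
by rewrite -[in X in _ <= X](prednK k1) exprS mulKf ?gt_eqF// betaE.
Qed.

Lemma admissible_avoiding :
  (\sum_(0 <= i <oo) (beta ^- l i)%:E < 1%:E)%E ->
  exists2 a, admissible k a & forall i, digit_sum a (l i) <> c i.
Proof.
move=> small.
(* Greedy descent: [node n] is the pair of the prefix of length [n] and its state. *)
pose d n r j := (j == 0%N) && `[< light n.+1 (r + 3 ^ n)%N k.-1 >].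
pose node := fix node n := if n is m.+1 then let: (r, j) := node m in
  ((r + d m r j * 3 ^ m)%N, next_state k (d m r j) j) else (0%N, 0%N).
pose a n := d n (node n).1 (node n).2.
have nodeS n : node n.+1 = ((node n).1 + a n * 3 ^ n, next_state k (a n) (node n).2)%N.
  by rewrite /a /=; case: (node n).
have nodeE n : (node n).1 = digit_sum a n.
  elim: n => [|n IHn]; first by rewrite /digit_sum big_ord0.
  by rewrite nodeS digit_sumS /= IHn.
have a_lt n : (digit_sum a n < 3 ^ n)%N.
  by apply: digit_sum_lt => j; case: (a j).
have lightP n : light n (digit_sum a n) (node n).2.
  elim: n => [|n IHn].
    rewrite /light /= expr0 invr1; apply: le_lt_trans small.
    apply: lee_nneseries => [i _ _|i _]; first exact: term_ge0.
    rewrite lee_fin; case: ifP => // _.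
    by rewrite invr_ge0 exprn_ge0// ltW.
  rewrite nodeS digit_sumS /= /a /d -nodeE; apply: light_step; rewrite nodeE//.
exists a => [|i ci].
  exists (fun n => (node n).2); split=> // n; rewrite nodeS; split=> //.
  by rewrite /a /d => /andP[/eqP].
(* If the prefix of length [l i] were [c i], the single term [i] would already make that prefix
   heavy. *)
have := lightP (l i); rewrite /light ltNge => /negP; apply.
apply: (@le_trans _ _ (beta ^- l i)%:E).
  rewrite lee_fin lef_pV2 ?posrE ?exprn_gt0// ler_weXn2l ?leq_addr//.
  exact: ltW.
have := nneseries_lim_ge (P := xpredT) (m := 0%N) i.+1
  (fun m _ _ => term_ge0 (l i) (digit_sum a (l i)) m).
rewrite -/(weight _ _) => ge_lim; apply: (le_trans _ ge_lim).
rewrite big_nat_recr//= leqnn -ci modn_small// eqxx leeDr// sume_ge0//.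
Qed.

End avoiding.

End growth.

(** * Hausdorff measure and dimension *)

Section hausdorff.
Context {R : realType}.
Local Notation Z3R := (Z3 : metricType R).

Lemma diam_le (U : set Z3R) (d : R) : 0 <= d ->
  (diam U <= d%:E)%E <-> forall x y, U x -> U y -> dist3 R x y <= d.
Proof.
move=> d0; rewrite /diam; case: eqP => [->|/eqP/set0P[x0 Ux0]].
  by split=> // _; rewrite lee_fin.
split=> [dU x y Ux Uy|dU].
  by rewrite -lee_fin (le_trans _ dU)//; apply: ereal_sup_ubound; exists (x, y).
by apply: ge_ereal_sup => _ [[x y] [/= Ux Uy] <-]; rewrite lee_fin; exact: dU.
Qed.

Lemma diam_ge0 (U : set Z3R) : (0 <= diam U)%E.
Proof.
rewrite /diam; case: eqP => // /eqP/set0P[x Ux].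
apply: (@le_trans _ _ (mdist x x)%:E); first by rewrite lee_fin; exact: dist3_ge0.
by apply: ereal_sup_ubound; exists (x, x).
Qed.

Lemma diam_pow_ge0 s (U : set Z3R) : (0 <= diam_pow s U)%E.
Proof. by rewrite /diam_pow; case: ifP => // _; exact: poweR_ge0. Qed.

Lemma hausdorff_premeasure_ge0 s delta (A : set Z3R) :
  (0 <= hausdorff_premeasure s delta A)%E.
Proof.
apply: le_ereal_inf_tmp => _ [U _ <-].
by apply: nneseries_ge0 => i _ _; exact: diam_pow_ge0.
Qed.

Lemma log3_gt0 (x : R) : 1 < x -> 0 < log3 x.
Proof. by move=> x1; rewrite /log3 divr_gt0// ln_gt0// ltr1n. Qed.

Lemma exprV_powR (x s : R) n : 0 < x -> (x ^- n) `^ s = (x `^ s) ^- n.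
Proof.
by move=> x0; rewrite -powR_invn ?ltW// -powRrM mulrC powRrM powR_invn// powR_ge0.
Qed.

Lemma powR_log3 (x : R) : 0 < x -> 3 `^ log3 x = x.
Proof.
move=> x0; rewrite /powR pnatr_eq0/= /log3 divfK ?lnK//.
by rewrite gt_eqF// ln_gt0// ltr1n.
Qed.

Lemma invf_exp_small (b e : R) : 1 < b -> 0 < e ->
  exists n, forall m, (n <= m)%N -> b ^- m <= e.
Proof.
move=> b1 e0.
have b0 : 0 < b by exact: lt_trans b1.
have bV : `|b^-1| < 1 by rewrite ger0_norm ?invr_ge0 ?ltW// invf_lt1.
have /cvgrPdist_le/(_ e e0)[N _ bN] := cvg_expr bV.
exists N => m /bN; rewrite sub0r normrN exprVn; exact: le_trans (ler_norm _).
Qed.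

Section dimension.
Variables (k : nat) (beta : R).
Hypotheses (k1 : (1 <= k)%N) (beta1 : 1 < beta).
Hypothesis betaE : beta ^+ k = beta ^+ k.-1 + 1.

Let beta_gt0 : 0 < beta. Proof. exact: lt_trans beta1. Qed.

(** The cylinders of the admissible prefixes of length [n] cover the set, and their total weight is
    at most [beta ^+ (n + k.-1) * (3]^ s) ^- n[, which tends to 0 because]3 [^ s] exceeds [beta]. *)
Lemma hausdorff_measure_eq0 s : log3 beta < s ->
  hausdorff_measure s (C1 (repunit3 k) : set Z3R) = 0%E.
Proof.
move=> ts; have s0 : 0 < s := lt_trans (log3_gt0 _ beta1) ts.
apply/eqP; rewrite eq_le; apply/andP; split; last first.
  apply: le_trans (hausdorff_premeasure_ge0 s 1 _) _.
  by apply: ereal_sup_ubound; exists 1 => //=.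
apply: ge_ereal_sup => _ [delta /= delta0 <-].
apply/lee_addgt0Pr => e e0; rewrite add0e.
have p1 : 1 < 3 `^ s / beta.
  rewrite ltr_pdivlMr// mul1r -[ltLHS]powR_log3// /powR pnatr_eq0/=.
  by rewrite ltr_expR ltr_pM2r// ln_gt0 ?ltr1n.
have [n1 n1P] := @invf_exp_small 3 delta (ltr1n _ 3) delta0.
have bk0 : 0 < beta ^+ k.-1 by rewrite exprn_gt0.
have [n2 n2P] := invf_exp_small _ _ p1 (divr_gt0 e0 bk0).
(* [n1] makes the diameters at most [delta], and [n2] makes the total weight at most [e]. The cover
   is padded with empty sets, whose [diam_pow] is 0. *)
pose n := maxn n1 n2; pose w := words k n 0.
pose U i : set Z3R :=
  if (i < size w)%N then [set x | res x n = nth 0%N w i] else set0.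
have diamU i : (diam (U i) <= (3 ^- n)%:E)%E.
  apply/diam_le; first by rewrite invr_ge0 exprn_ge0.
  by rewrite /U; case: ifP => // _ x y /= xi yi; apply/dist3_le; rewrite xi.
apply: (@le_trans _ _ (\sum_(0 <= i <oo) diam_pow s (U i))%E).
  apply: ereal_inf_lbound; exists U => //; split=> [x|i]; last first.
    by apply: le_trans (diamU i) _; rewrite lee_fin n1P// leq_maxl.
  move=> /(C1_repunit3P _ _ k1)[a [r [r0 rP]] /ternary_expansionP ax].
  have aw : digit_sum a n \in w by rewrite /w -r0; exact: digit_sum_words.
  by exists (index (digit_sum a n) w) => //; rewrite /U index_mem aw /= nth_index.
rewrite (nneseries_split _ (size w)); last by move=> i _; exact: diam_pow_ge0.
rewrite add0n [X in (_ + X)%E]eseries0 ?adde0; last first.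
  by move=> i wi _; rewrite /U ltnNge wi /= /diam_pow eqxx.
apply: (@le_trans _ _ (\sum_(0 <= i < size w) ((3 ^- n) `^ s)%:E)%E).
  apply: lee_sum => i _; rewrite /diam_pow; case: ifP => [_|_].
    by rewrite lee_fin powR_ge0.
  rewrite -poweR_EFin gt0_ler_poweR ?(ltW s0)// in_itv /= ?diam_ge0 ?leey//.
  by rewrite lee_fin invr_ge0 exprn_ge0.
rewrite sumEFin lee_fin sumr_const_nat subn0 exprV_powR// -[leLHS]mulr_natl.
have := size_words k beta k1 beta1 betaE n 0 (leq0n _).
rewrite -/w subn0 => wn; apply: (@le_trans _ _ (beta ^+ (n + k.-1) * (3 `^ s) ^- n)).
  by rewrite ler_wpM2r// invr_ge0 exprn_ge0// powR_ge0.
have := n2P n (leq_maxr _ _); rewrite ler_pdivlMr//; apply: le_trans.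
by rewrite expr_div_n invf_div exprD mulrAC.
Qed.

(** If the diameter [d] satisfies [3 ^- l.+1 < d <= 3 ^- l], then [U] lies in a cylinder of level
    [l], and [beta ^- l] is at most [beta * d]^ log3 beta[, hence at most]beta * d [^ s] as
    [d <= 1]. The term [e] serves empty sets and single points, which fit in arbitrarily deep
    cylinders. *)
Lemma cover_by_cylinder s e (U : set Z3R) :
  0 <= s <= log3 beta -> 0 < e -> (diam U <= 1%:E)%E ->
  exists l c, (forall x, U x -> res x l = c) /\
    ((beta ^- l)%:E <= beta%:E * diam_pow s U + e%:E)%E.
Proof.
move=> /andP[s0 st] e0 U1; have [n /(_ n (leqnn n)) ne] := invf_exp_small _ _ beta1 e0.
have small : ((beta ^- n)%:E <= beta%:E * diam_pow s U + e%:E)%E.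
  by rewrite -[leLHS]add0e leeD// ?lee_fin// mule_ge0 ?lee_fin ?(ltW beta_gt0)// diam_pow_ge0.
have [U0|/set0P[x0 Ux0]] := eqVneq U set0.
  by exists n, 0%N; split=> // x; rewrite U0.
have [d dE] : exists d, diam U = d%:E.
  move: U1 (diam_ge0 U); case: (diam U) => [d _ _|//|//]; by exists d.
have d0 : 0 <= d by rewrite -lee_fin -dE diam_ge0.
have Ud : forall l, d <= 3 ^- l -> forall x, U x -> res x l = res x0 l.
  move=> l dl x Ux; apply/(dist3_le R); apply: le_trans dl.
  by apply: ((diam_le U _ d0).1 _ x x0 Ux Ux0); rewrite dE.
have [dz|dn0] := eqVneq d 0.
  exists n, (res x0 n); split=> //; apply: Ud.
  by rewrite dz invr_ge0 exprn_ge0.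
have {}d0 : 0 < d by rewrite lt_neqAle eq_sym dn0.
have d1 : d <= 1 by rewrite -lee_fin -dE.
have ex : exists m, 3 ^- m < d by exact: exp3_small.
case: (ex_minnP ex) => -[|l] ld lmin.
  by move: ld; rewrite expr0 invr1 ltNge d1.
exists l, (res x0 l); split.
  by apply: Ud; rewrite leNgt; apply/negP => /lmin; rewrite ltnn.
rewrite -[leLHS]adde0 leeD ?lee_fin ?(ltW e0)//.
have -> : diam_pow s U = (d `^ s)%:E.
  by rewrite /diam_pow ifF ?dE//; apply/negbTE/set0P; exists x0.
rewrite -EFinM lee_fin.
have -> : beta ^- l = beta * beta ^- l.+1.
  by rewrite exprS invfM mulVKf ?gt_eqF.
rewrite ler_pM2l//.
have -> : beta ^- l.+1 = (3 ^- l.+1) `^ log3 beta.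
  by rewrite exprV_powR// powR_log3.
have t0 : 0 <= log3 beta by exact: le_trans st.
apply: (@le_trans _ _ (d `^ log3 beta)).
  by rewrite ge0_ler_powR// ?nnegrE ?invr_ge0 ?exprn_ge0// ltW.
by rewrite ger_powR// d0 d1.
Qed.

Lemma hausdorff_measure_neq0 s : 0 <= s <= log3 beta ->
  hausdorff_measure s (C1 (repunit3 k) : set Z3R) <> 0%E.
Proof.
(* With this [e] a cover contributes less than [beta * e = 1/4], and the errors [2^-1 / 2 ^ i.+1]
   sum to 1/2. The total stays below the 1 required by [admissible_avoiding]. *)
move=> st H0; pose e := (4 * beta)^-1.
have : (hausdorff_premeasure s 1%R (C1 (repunit3 k) : set Z3R) < e%:E)%E.
  apply: (@le_lt_trans _ _ 0%E); last by rewrite lte_fin invr_gt0 mulr_gt0.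
  by rewrite -H0; apply: ereal_sup_ubound; exists 1 => //=.
move=> /ereal_inf_lt[_ [U [UC U1] <-] Ue].
have lc i : exists lc : nat * nat, (forall x, U i x -> res x lc.1 = lc.2) /\
    ((beta ^- lc.1)%:E <= beta%:E * diam_pow s (U i) + (2^-1 / (2 ^ i.+1)%:R)%:E)%E.
  have [||l [c lcP]] := @cover_by_cylinder s (2^-1 / (2 ^ i.+1)%:R) (U i) st.
  - by rewrite divr_gt0// ltr0n expn_gt0.
  - exact: U1.
  - by exists (l, c).
move/choice: lc => [lc lcP].
have [] := @admissible_avoiding R k beta k1 beta1 betaE (fst \o lc) (snd \o lc).
  apply: (@le_lt_trans _ _ (\sum_(0 <= i <oo)
      (beta%:E * diam_pow s (U i) + (2^-1 / (2 ^ i.+1)%:R)%:E))%E).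
    apply: lee_nneseries => [i _ _|i _]; last exact: (lcP i).2.
    by rewrite lee_fin invr_ge0 exprn_ge0// ltW.
  have bd0 i : (0 <= beta%:E * diam_pow s (U i))%E.
    by rewrite mule_ge0 ?lee_fin ?(ltW beta_gt0)// diam_pow_ge0.
  apply: (le_lt_trans (epsilon_trick _ bd0 _)) => //.
  rewrite nneseriesZl; last by move=> i _; exact: diam_pow_ge0.
  apply: (@lt_le_trans _ _ (beta%:E * e%:E + 2^-1%:E)%E).
    by rewrite lteD2rE// lte_pmul2l.
  rewrite -EFinM -EFinD lee_fin /e invfM mulrCA divff ?gt_eqF// mulr1.
  lra.
move=> a adm avoid.
have [i _ Uix] : (\bigcup_i U i) (Z3_digits a).
  by apply: UC; apply/(C1_repunit3P _ _ k1); exists a => //; exact: Z3_digitsP.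
apply: (avoid i); rewrite /= -((lcP i).1 _ Uix).
by have /ternary_expansionP -> := Z3_digitsP a.
Qed.

Lemma dimH_C1_repunit3 : dimH (C1 (repunit3 k) : set Z3R) = (log3 beta)%:E.
Proof.
have t0 := log3_gt0 _ beta1.
apply/eqP; rewrite eq_le; apply/andP; split.
  apply/lee_addgt0Pr => e e0; apply: ereal_inf_lbound; exists (log3 beta + e) => //.
  by split; [rewrite addr_ge0 ?ltW|apply: hausdorff_measure_eq0; rewrite ltrDl].
apply: le_ereal_inf_tmp => _ [s [s0 H0] <-]; rewrite lee_fin leNgt.
by apply/negP => /ltW st; apply: hausdorff_measure_neq0 H0; rewrite s0.
Qed.

End dimension.

End hausdorff.

(** * The root beta and its logarithm for large k *)

Section asymptotics.
Context {R : realType}.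

Lemma pow_eq_subr1 k (x : R) : (1 <= k)%N ->
  (x ^+ k - x ^+ k.-1 - 1 = 0) <-> x ^+ k.-1 * (x - 1) = 1.
Proof.
move=> k1; rewrite mulrBr mulr1 -exprSr prednK//.
by split=> [/eqP|->]; rewrite ?subrr// subr_eq0 => /eqP.
Qed.

(** The left-hand side is strictly increasing for arguments above 1. *)
Lemma beta_unique k (x y : R) : 1 < x -> 1 < y ->
  x ^+ k * (x - 1) = 1 -> y ^+ k * (y - 1) = 1 -> x = y.
Proof.
wlog xy : x y / x <= y => [th x1 y1 xE yE|].
  by have [/th->//|/ltW/th->] := leP x y.
move=> x1 y1 xE yE; apply/eqP; move: xy; rewrite le_eqVlt => /predU1P[->//|xy].
have : x ^+ k * (x - 1) < y ^+ k * (y - 1).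
  apply: (@le_lt_trans _ _ (y ^+ k * (x - 1))).
    by rewrite ler_wpM2r ?subr_ge0 ?(ltW x1)// lerXn2r ?nnegrE; lra.
  by rewrite ltr_pM2l ?ltrD2r// exprn_gt0//; lra.
by rewrite xE yE ltxx.
Qed.

(** Intermediate values on [1, 2]: the function is 0 at 1 and [2 ^+ k] at 2. The bound 2 is kept for
    the estimate of [ln b]. *)
Lemma beta_exists k : exists2 x : R, 1 < x <= 2 & x ^+ k * (x - 1) = 1.
Proof.
have le12 : (1 : R) <= 2 by lra.
pose f (x : R) := x ^+ k * (x - 1).
have cf : {within `[1, 2], continuous f}.
  apply: continuous_subspaceT => x; apply: cvgM; first exact: exprn_continuous.
  by apply: cvgB; [exact: cvg_id|exact: cvg_cst].
have f1 : f 1 = 0 by rewrite /f subrr mulr0.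
have f2 : 1 <= f 2 by rewrite /f (_ : 2 - 1 = 1) ?mulr1 ?exprn_ege1//; lra.
have [|x x12 fx] := IVT le12 cf (v := 1).
  by rewrite f1 min_l ?max_r// ?f2; lra.
move: x12; rewrite in_itv/= => /andP[x1 x2]; exists x => //; rewrite x2 andbT.
rewrite lt_neqAle x1 andbT; apply/eqP => x1E.
by move: fx; rewrite -x1E f1 => /eqP; rewrite eq_sym oner_eq0.
Qed.

(** This makes [ln (ln k)] positive from [k = 3] on. From [expR (- 6^-1) >= 5/6] follows e <=
    (6/5)^6 < 3. *)
Lemma ln3_gt1 : 1 < ln (3 : R).
Proof.
rewrite -[ltLHS]expRK ltr_ln ?posrE ?expR_gt0//.
have e6 : expR (6^-1 : R) <= 6 / 5.
  have := expR_ge1Dx (- 6^-1 : R); rewrite expRN => h.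
  rewrite -[leLHS]invrK -[leRHS]invrK lef_pV2 ?posrE ?invr_gt0 ?expR_gt0//.
  by apply: le_trans h; rewrite invf_div; lra.
have -> : expR 1 = expR (6^-1 : R) ^+ 6.
  by rewrite -expRM_natl; congr expR; field.
apply: (@le_lt_trans _ _ ((6 / 5) ^+ 6)); last by lra.
by rewrite lerXn2r ?nnegrE ?expR_ge0//; lra.
Qed.

(* Writing x = ln beta, the equation beta^(k-1) (beta - 1) = 1 says
   e^(kx) (1 - e^(-x)) = 1, and x <= beta - 1 while 1 - e^(-x) <= x. *)
Lemma ln_beta_bound k (b : R) : (3 <= k)%N -> 1 < b <= 2 ->
  b ^+ k.-1 * (b - 1) = 1 ->
  `|k%:R * ln b - ln k%:R| <= 1 + ln (ln k%:R).
Proof.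
move=> k3 /andP[b1 b2] bE; set K : R := k%:R; set x := ln b.
have b0 : 0 < b by lra.
have K3 : 3 <= K by rewrite /K (ler_nat _ 3).
have K0 : 0 < K by lra.
have lnK1 : 1 < ln K.
  by apply: (lt_le_trans ln3_gt1); rewrite ler_ln ?posrE//; lra.
have lnlnK0 : 0 < ln (ln K) by rewrite ln_gt0.
have x0 : 0 < x by rewrite ln_gt0.
have xb : x <= b - 1.
  by have := @le_ln1Dx _ (b - 1); rewrite [1 + _]addrC subrK; apply; lra.
have lnE : (K - 1) * x + ln (b - 1) = 0.
  have : ln (b ^+ k.-1 * (b - 1)) = 0 by rewrite bE ln1.
  rewrite lnM ?posrE ?exprn_gt0 ?subr_gt0// lnXn// -mulr_natl.
  suff -> : K - 1 = k.-1%:R by [].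
  by rewrite -subn1 natrB// (ltn_trans _ k3).
have lexln : ln x <= ln (b - 1) by rewrite ler_ln ?posrE ?subr_gt0.
(* As [x <= b - 1 <= 1], [lnE] gives [K * x <= 1 - ln x], and [- ln x < ln K] once [K * x > 1]. *)
have upper : K * x <= ln K + 1.
  have [Kx|Kx] := leP (K * x) 1; first by lra.
  have : 0 < ln (K * x) by rewrite ln_gt0.
  by rewrite lnM ?posrE//; lra.
have lower : - ln x <= K * x.
  have : ln (b - 1) <= ln (b * x).
    rewrite ler_ln ?posrE ?mulr_gt0 ?subr_gt0//.
    have : - x <= b^-1 - 1.
      have := @le_ln1Dx _ (b^-1 - 1); rewrite [1 + _]addrC subrK lnV ?posrE//; apply.
      by have : 0 < b^-1 by [rewrite invr_gt0]; lra.
    move=> h; have := ler_wpM2l (ltW b0) h.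
    by rewrite mulrBr divff ?gt_eqF// mulr1; lra.
  by rewrite lnM ?posrE// -/x; lra.
(* The upper bound is fed back: [K * x <= ln K + 1 <= 2 * ln K <= expR 1 * ln K]. With [lower] this
   bounds [K * x] from below. *)
have lnx : ln x <= 1 + ln (ln K) - ln K.
  have : ln (K * x) <= ln (expR 1 * ln K).
    rewrite ler_ln ?posrE ?mulr_gt0 ?expR_gt0//; last by lra.
    apply: (le_trans upper).
    have : 2 * ln K <= expR 1 * ln K.
      by rewrite ler_wpM2r//; [lra|have := expR_ge1Dx (1 : R); lra].
    lra.
  by rewrite !lnM ?posrE ?expR_gt0// ?expRK; lra.
by rewrite ler_norml; apply/andP; split; lra.
Qed.

Lemma log3_beta_bound : exists2 C : R, 0 < C &
  forall k b, (3 <= k)%N -> 1 < b <= 2 -> b ^+ k.-1 * (b - 1) = 1 ->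
    `|log3 b - log3 k%:R / k%:R| <= C * (ln (ln k%:R) / k%:R).
Proof.
have l3 := ln3_gt1; have ll3 : 0 < ln (ln (3 : R)) by rewrite ln_gt0.
(* The additive 1 of [ln_beta_bound] is absorbed by [(ln (ln 3))^-1 * ln (ln K) >= 1]; dividing by
   [ln 3 > 1] only helps. *)
exists (1 + (ln (ln 3))^-1); first by rewrite addr_gt0 ?invr_gt0.
move=> k b k3 b12 bE; have := ln_beta_bound _ _ k3 b12 bE.
have K3 : 3 <= k%:R :> R by rewrite (ler_nat _ 3).
move: (k%:R) K3 => K K3 bd; have K0 : 0 < K by lra.
have lnK : ln 3 <= ln K by rewrite ler_ln ?posrE.
have lnlnK : ln (ln 3) <= ln (ln K) by rewrite ler_ln ?posrE//; lra.
have -> : log3 b - log3 K / K = (K * ln b - ln K) / (ln 3 * K).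
  by rewrite /log3; field; rewrite !gt_eqF//; lra.
rewrite normrM [`|(_ * _)^-1|]ger0_norm ?invr_ge0 ?mulr_ge0//; [|lra..].
rewrite mulrA ler_pdivrMr; last by rewrite mulr_gt0//; lra.
rewrite [leRHS](_ : _ = (1 + (ln (ln 3))^-1) * ln (ln K) * ln 3); last first.
  by field; rewrite !gt_eqF//; lra.
have inv1 : 1 <= (ln (ln 3))^-1 * ln (ln K).
  by rewrite mulrC ler_pdivlMr// mul1r.
apply: (le_trans bd); apply: (@le_trans _ _ ((1 + (ln (ln 3))^-1) * ln (ln K))).
  by rewrite mulrDl mul1r; lra.
rewrite ler_peMr// ?ltW// mulr_gt0//; last by lra.
by rewrite addr_gt0 ?invr_gt0.
Qed.

End asymptotics.

Theorem theorem1p7 (R : realType) :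
  [/\ (forall k : nat, (1 <= k)%N ->
         [/\ X1 (repunit3 k) = path_set (repunit3 k),
             (vertices (repunit3 k) #= `I_k)%card &
             strongly_connected (vertices (repunit3 k)) (graph_rel (repunit3 k))]),
      (forall k : nat, (1 <= k)%N ->
         exists2 beta : R,
           unique (fun x : R => 1 < x /\ x ^+ k - x ^+ k.-1 - 1 = 0) beta &
           dimH (R := R) (C1 (repunit3 k)) = (log3 beta)%:E) &
      exists2 K : R, 0 < K &
        forall k : nat, (3 <= k)%N ->
          (`| dimH (R := R) (C1 (repunit3 k)) - (log3 (k%:R : R) / k%:R)%:E |
             <= (K * (ln (ln k%:R) / k%:R))%:E)%E].
Proof.
have betaP k b : (1 <= k)%N -> 1 < b -> b ^+ k.-1 * (b - 1) = 1 ->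
    dimH (R := R) (C1 (repunit3 k)) = (log3 b)%:E.
  move=> k1 b1 /(pow_eq_subr1 _ _ k1)/eqP bE; apply: dimH_C1_repunit3 => //.
  by apply/eqP; rewrite -subr_eq0 opprD addrA.
split=> [k k1|k k1|].
- split; [exact/X1_path_set/repunit3_mod|exact: card_vertices|].
  exact: strongly_connected_repunit3.
- have [b /andP[b1 _] bE] := @beta_exists R k.-1.
  exists b; last exact: betaP.
  split=> [|y [y1 /(pow_eq_subr1 _ _ k1)]]; last exact: beta_unique.
  by split=> //; exact/(pow_eq_subr1 _ _ k1).
have [K K0 KP] := @log3_beta_bound R; exists K => // k k3.
have [b b12 bE] := @beta_exists R k.-1.
have k1 : (1 <= k)%N by exact: ltn_trans k3.
rewrite (betaP k b k1 _ bE); last by case/andP: b12.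
by rewrite -EFinB abse_EFin lee_fin KP.
Qed.
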